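(* Let $f:\mathbb{R}^d\to\mathbb{R}$ be $L$-smooth and $\mu$-strongly convex in the Euclidean norm $\|\cdot\|_2$, with $\mu>0$, and let $x^*$ be its minimizer. Let $g(x,y)=(y,\ \nabla f^*(y)-x)$ and $r(x,y)=\frac{\mu}{2}\|x\|_2^2+f^*(y)$ on $\mathbb{R}^d\times\mathbb{R}^d$, and let $\lambda=1+\sqrt{L/\mu}$. Let $x_0\in\mathbb{R}^d$, let $T\ge 4\lambda$ be an integer, set $z_0=(x_0,\nabla f(x_0))$, and for $0\le t<T$ let $$w_t=\mathrm{Prox}^r_{z_t}\left(\tfrac1\lambda g(z_t)\right),\qquad z_{t+1}=\mathrm{Prox}^r_{z_t}\left(\tfrac1\lambda g(w_t)\right).$$ Write $w_t=(x_{t+1/2},\nabla f(v_{t+1/2}))$ and define $\bar v=\frac1T\sum_{0\le t<T}v_{t+1/2}$. Then $$f(\bar v)-f(x^* )\le\tfrac12\left(f(x_0)-f(x^* )\right).$$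
   Context: $L$-smooth in $\|\cdot\|_2$: $f$ is differentiable and $\|\nabla f(x)-\nabla f(y)\|_2\le L\|x-y\|_2$ for all $x,y$. $\mu$-strongly convex in $\|\cdot\|_2$: $f(y)\ge f(x)+\langle\nabla f(x),y-x\rangle+\frac\mu2\|y-x\|_2^2$ for all $x,y$. Fenchel dual: $f^*(y)=\max_x\{\langle y,x\rangle-f(x)\}$; under these assumptions $f^*$ is finite and differentiable on $\mathbb{R}^d$ and $\nabla f,\nabla f^*$ are inverse bijections of $\mathbb{R}^d$, so that $v_{t+1/2}$ is the unique point whose gradient is the second block of $w_t$. Bregman divergence: $V^r_z(w)=r(w)-r(z)-\langle\nabla r(z),w-z\rangle$. Proximal operation: $\mathrm{Prox}^r_z(\xi)=\mathrm{argmin}_{w}\{\langle\xi,w\rangle+V^r_z(w)\}$, here with $w$ ranging over $\mathbb{R}^d\times\mathbb{R}^d$. The operator $g$ is the gradient operator of the convex-concave problem $\min_x\max_y\langle y,x\rangle-f^*(y)$. *)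

(* Defs.v *)
From HB Require Import structures.
From mathcomp Require Import all_boot all_order all_algebra.
From mathcomp Require Import all_classical all_reals all_analysis.

Set Implicit Arguments.
Unset Strict Implicit.
Unset Printing Implicit Defensive.

Import Order.TTheory GRing.Theory Num.Theory.
Import numFieldNormedType.Exports.

Local Open Scope classical_set_scope.
Local Open Scope ring_scope.

(* Vectors of R^n are row vectors 'rV[R]_n, and R^d x R^d is 'rV[R]_(d + d), a
   pair (x, y) being row_mx x y.  The norm `|x| that the library puts on
   'rV[R]_n is the sup norm, hence the explicit Euclidean norm below; the
   notion of differentiability is the same for both norms. *)

Definition dot (R : realType) n (u v : 'rV[R]_n) : R :=
  \sum_(i < n) u 0 i * v 0 i.

Definition norm2 (R : realType) n (u : 'rV[R]_n) : R := Num.sqrt (dot u u).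

Definition grad (R : realType) n (f : 'rV[R]_n -> R) (x : 'rV[R]_n) : 'rV[R]_n :=
  \row_(i < n) 'D_(delta_mx 0 i) f x.

Definition smooth (R : realType) n (L : R) (f : 'rV[R]_n -> R) : Prop :=
  (forall x, differentiable f x) /\
  (forall x y, norm2 (grad f x - grad f y) <= L * norm2 (x - y)).

Definition strongly_convex (R : realType) n (mu : R) (f : 'rV[R]_n -> R) : Prop :=
  forall x y,
    f x + dot (grad f x) (y - x) + mu / 2 * norm2 (y - x) ^+ 2 <= f y.

(* This is the maximum whenever it is attained, in particular for a smooth and
   strongly convex f; the real-valued sup is 0 on sets without a supremum. *)
Definition fenchel (R : realType) n (f : 'rV[R]_n -> R) (y : 'rV[R]_n) : R :=
  sup [set dot y x - f x | x in [set: 'rV[R]_n]].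

Definition bregman (R : realType) n (r : 'rV[R]_n -> R) (z w : 'rV[R]_n) : R :=
  r w - r z - dot (grad r z) (w - z).

Definition argmin (R : realType) n (F : 'rV[R]_n -> R) : set 'rV[R]_n :=
  [set w | forall u, F w <= F u].

(* [get] selects an element of the argmin set, and returns a default point if
   that set is empty. *)
Definition prox (R : realType) n (r : 'rV[R]_n -> R) (z xi : 'rV[R]_n) :
    'rV[R]_n :=
  get (argmin (fun w => dot xi w + bregman r z w)).

Definition saddle_op (R : realType) d (f : 'rV[R]_d -> R)
    (z : 'rV[R]_(d + d)) : 'rV[R]_(d + d) :=
  row_mx (rsubmx z) (grad (fenchel f) (rsubmx z) - lsubmx z).

Definition regularizer (R : realType) d (mu : R) (f : 'rV[R]_d -> R)
    (z : 'rV[R]_(d + d)) : R :=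
  mu / 2 * norm2 (lsubmx z) ^+ 2 + fenchel f (rsubmx z).

(* Main.v *)
Require Import Defs.
From HB Require Import structures.
From mathcomp Require Import all_boot all_order all_algebra.
From mathcomp Require Import all_classical all_reals all_analysis.
From mathcomp Require Import ring lra.
Import Order.TTheory GRing.Theory Num.Theory.
Import numFieldNormedType.Exports.
Local Open Scope classical_set_scope.
Local Open Scope ring_scope.

(* Every dual iterate stays in the range of grad f, where f^* and its gradient
   are explicit: f^*(grad f a) = <grad f a, a> - f a and grad f^* (grad f a) = a.
   Hence the proximal steps have the closed form of [prox_row_mx], and z_t can
   be written (x, grad f a).  With kappa = sqrt (L / mu), the operator g is
   (1 + kappa)-relatively Lipschitz with respect to r, by cocoercivity of grad f
   and AM-GM, so each extragradient step satisfies
     f(v_{t+1/2}) - f(xstar) <= lambda (V^r_{z_t}(u) - V^r_{z_{t+1}}(u))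
   at u = (xstar, 0).  Summing, Jensen's inequality bounds T (f(vbar) - f(xstar)) by
   lambda V^r_{z_0}(u) <= 2 lambda (f(x_0) - f(xstar)). *)

Set Implicit Arguments.
Unset Strict Implicit.

(** * The Euclidean inner product *)

Lemma dotC (R : realType) n (u v : 'rV[R]_n) : dot u v = dot v u.
Proof. by apply: eq_bigr => i _; rewrite mulrC. Qed.

Lemma dotDl (R : realType) n (u v x : 'rV[R]_n) :
  dot (u + v) x = dot u x + dot v x.
Proof. by rewrite /dot -big_split; apply: eq_bigr => i _; rewrite mxE mulrDl. Qed.

Lemma dotZl (R : realType) n (c : R) (u v : 'rV[R]_n) :
  dot (c *: u) v = c * dot u v.
Proof. by rewrite /dot mulr_sumr; apply: eq_bigr => i _; rewrite mxE mulrA. Qed.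

Lemma dotNl (R : realType) n (u v : 'rV[R]_n) : dot (- u) v = - dot u v.
Proof. by rewrite -scaleN1r dotZl mulN1r. Qed.

Lemma dotDr (R : realType) n (u v x : 'rV[R]_n) :
  dot x (u + v) = dot x u + dot x v.
Proof. by rewrite dotC dotDl !(dotC x). Qed.

Lemma dotZr (R : realType) n (c : R) (u v : 'rV[R]_n) :
  dot u (c *: v) = c * dot u v.
Proof. by rewrite dotC dotZl dotC. Qed.

Lemma dotNr (R : realType) n (u v : 'rV[R]_n) : dot u (- v) = - dot u v.
Proof. by rewrite dotC dotNl dotC. Qed.

Definition dot_linE := (dotDl, dotDr, dotNl, dotNr, dotZl, dotZr).

Lemma dot0r (R : realType) n (u : 'rV[R]_n) : dot u 0 = 0.
Proof. by rewrite /dot big1 // => i _; rewrite mxE mulr0. Qed.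

Lemma dot_sumr (R : realType) n (u : 'rV[R]_n) (T : nat) (v : nat -> 'rV[R]_n) :
  dot u (\sum_(0 <= t < T) v t) = \sum_(0 <= t < T) dot u (v t).
Proof.
elim: T => [|T IH]; first by rewrite !big_geq // dot0r.
by rewrite !big_nat_recr //= dotDr IH.
Qed.

Lemma dot_ge0 (R : realType) n (u : 'rV[R]_n) : 0 <= dot u u.
Proof. by apply: sumr_ge0 => i _; rewrite -expr2 sqr_ge0. Qed.

Lemma dot_eq0 (R : realType) n (u : 'rV[R]_n) : dot u u <= 0 -> u = 0.
Proof.
move=> u0; have /eqP : dot u u = 0 by apply/eqP; rewrite eq_le u0 dot_ge0.
rewrite psumr_eq0 => [/allP uu|i _]; last by rewrite -expr2 sqr_ge0.
apply/rowP => i; rewrite mxE; apply/eqP.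
by have := uu i (mem_index_enum i); rewrite -expr2 sqrf_eq0.
Qed.

Lemma dot_row_mx (R : realType) m n (u u' : 'rV[R]_m) (v v' : 'rV[R]_n) :
  dot (row_mx u v) (row_mx u' v') = dot u u' + dot v v'.
Proof.
rewrite /dot big_split_ord /=; congr (_ + _); apply: eq_bigr => i _.
  by rewrite !row_mxEl.
by rewrite !row_mxEr.
Qed.

Lemma sqr_norm2 (R : realType) n (u : 'rV[R]_n) : norm2 u ^+ 2 = dot u u.
Proof. by rewrite sqr_sqrtr // dot_ge0. Qed.

(** Expanding the square of [u - c *: v] replaces Cauchy-Schwarz. This turns the Lipschitz bound on
    the gradient into a bound on a directional derivative. *)
Lemma dot_le_norm2 (R : realType) n (c : R) (u v : 'rV[R]_n) :
  0 < c -> norm2 u <= c * norm2 v -> dot u v <= c * dot v v.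
Proof.
move=> c0 uv.
have : dot u u <= c ^+ 2 * dot v v.
  rewrite -!sqr_norm2 -exprMn ler_pXn2r // nnegrE ?sqrtr_ge0 //.
  by rewrite mulr_ge0 ?sqrtr_ge0 // ltW.
have := dot_ge0 (u - c *: v); rewrite !dot_linE (dotC v u) => h1 h2.
rewrite -(ler_pM2l c0).
nra.
Qed.

Lemma dot_delta_mx (R : realType) n (u : 'rV[R]_n) (i : 'I_n) :
  dot u (delta_mx 0 i) = u 0 i.
Proof.
rewrite /dot (bigD1 i) //= mxE !eqxx mulr1 big1 ?addr0 // => j ji.
by rewrite mxE (negbTE ji) andbF mulr0.
Qed.

(** * Gradients, directional derivatives and the descent lemma *)

(** Along [h *: delta_mx 0 i] the difference quotient is within [C * |h|] of [a 0 i]. Since [grad]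
    collects partial derivatives, this computes gradients of f^* and of the regularizer from a
    quadratic remainder alone. *)
Lemma grad_unique (R : realType) n (F : 'rV[R]_n -> R) (x a : 'rV[R]_n) (C : R) :
  (forall v, `|F (x + v) - F x - dot a v| <= C * dot v v) -> grad F x = a.
Proof.
move=> hF; apply/rowP => i; rewrite mxE /derive.
apply/cvg_lim => //; apply/cvgrPdist_le => e e0.
(* The sign of [C] is unknown; [|C| + 1] is a positive upper bound for it. *)
have C1 : 0 < `|C| + 1 by rewrite ltr_wpDl.
near=> h.
have h0 : h != 0 by near: h; exact: nbhs_dnbhs_neq.
have hle : `|h| <= e / (`|C| + 1).
  near: h; apply: dnbhs0_le; exact: divr_gt0.
rewrite /= /GRing.scale /=.
have := hF (h *: delta_mx 0 i); rewrite !dot_linE !dot_delta_mx mxE !eqxx mulr1.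
rewrite [x + _]addrC; set D := F _ - F x => hD.
have -> : a 0 i - h^-1 * D = - (h^-1 * (D - h * a 0 i)) by field.
rewrite normrN normrM normfV -(ler_pM2l (_ : 0 < `|h|)) ?normr_gt0 //.
rewrite mulrA divff ?normr_eq0 // mul1r (le_trans hD) //.
have -> : h * h = `|h| * `|h| by rewrite -!expr2 real_normK ?num_real.
rewrite mulrCA ler_wpM2l //.
rewrite ler_pdivlMr // in hle.
apply: le_trans hle; rewrite mulrC ler_wpM2l //.
by rewrite (le_trans (ler_norm C)) // lerDl.
Unshelve. all: by end_near. Qed.

Lemma derive_grad (R : realType) n (f : 'rV[R]_n -> R) (x v : 'rV[R]_n) :
  differentiable f x -> 'D_v f x = dot (grad f x) v.
Proof.
move=> df; rewrite deriveE // {1}(row_sum_delta v) linear_sum.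
apply: eq_bigr => i _; rewrite linearZ mxE -deriveE //.
by rewrite /GRing.scale /= mulrC.
Qed.

Lemma is_derive_line (R : realType) n (f : 'rV[R]_n -> R) (x v : 'rV[R]_n) (t : R) :
  differentiable f (x + t *: v) ->
  is_derive t 1 (fun s : R => f (x + s *: v)) (dot (grad f (x + t *: v)) v).
Proof.
move=> df; rewrite -derive_grad //.
have E : (fun h : R => h^-1 *: (((fun s : R => f (x + s *: v)) \o shift t) (h *: 1)
     - f (x + t *: v))) =
   (fun h : R => h^-1 *: ((f \o shift (x + t *: v)) (h *: v) - f (x + t *: v))).
  apply/funext => h /=; congr (_ *: (f _ - _)).
  have -> : h *: (1 : R) = h by exact: mulr1.
  by rewrite scalerDl addrCA.
split; rewrite /derivable /derive E //.
exact: diff_derivable df.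
Qed.

(** On the segment, f minus its quadratic model has nonpositive derivative, so the mean value
    theorem suffices. *)
Lemma smooth_upper_bound (R : realType) n (L : R) (f : 'rV[R]_n -> R) (x y : 'rV[R]_n) :
  0 < L -> smooth L f ->
  f y <= f x + dot (grad f x) (y - x) + L / 2 * dot (y - x) (y - x).
Proof.
move=> L0 [df lf]; rewrite -{1}[y](subrK x) addrC; move: (y - x) => v {y}.
pose phi (t : R) := f (x + t *: v).
pose psi (t : R) := dot (grad f x) v * t + L / 2 * dot v v * t ^+ 2.
pose dF (t : R) := dot (grad f (x + t *: v)) v -
  (dot (grad f x) v + L * dot v v * t).
have dphi (t : R) : is_derive t 1 (fun s => phi s - psi s) (dF t).
  apply: is_deriveB; first exact: is_derive_line.
  rewrite /psi; apply: is_derive_eq.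
  rewrite /GRing.scale /=; lra.
have [|c c01] := @MVT R _ dF 0 1 ltr01 (fun t _ => dphi t).
  apply: derivable_within_continuous => t _; exact: (@ex_derive _ _ _ _ _ _ _ (dphi t)).
have /andP[c0 c1] : 0 < c < 1 by rewrite in_itv in c01.
have dFc : dF c <= 0.
  rewrite /dF.
  (* The displacement from [x] is [c *: v], whence the constant [L * c] relative to [v]. *)
  have := @dot_le_norm2 R n (L * c) (grad f (x + c *: v) - grad f x) v (mulr_gt0 L0 c0).
  have -> : L * c * norm2 v = L * norm2 (x + c *: v - x).
    rewrite (addrC x) addrK /norm2 !dot_linE mulrA -expr2 sqrtrM ?sqr_ge0 //.
    by rewrite sqrtr_sqr gtr0_norm // mulrA.
  move=> /(_ (lf _ _)); rewrite !dot_linE; lra.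
rewrite /phi /psi scale0r addr0 scale1r expr0n expr1n /=; lra.
Qed.

(** * Quadratic bounds on the Fenchel dual and its gradient *)

Lemma strongly_convex_dot (R : realType) n (mu : R) (f : 'rV[R]_n -> R) :
  strongly_convex mu f -> forall x y : 'rV[R]_n,
  f x + dot (grad f x) (y - x) + mu / 2 * dot (y - x) (y - x) <= f y.
Proof. by move=> cf x y; rewrite -sqr_norm2; exact: cf. Qed.

Lemma dot_le_amgm (R : realType) n (c : R) (u v : 'rV[R]_n) :
  0 < c -> dot u v <= c / 2 * dot v v + (2 * c)^-1 * dot u u.
Proof.
move=> c0; rewrite -subr_ge0.
have -> : c / 2 * dot v v + (2 * c)^-1 * dot u u - dot u v =
    (2 * c)^-1 * dot (c *: v - u) (c *: v - u).
  by rewrite !dot_linE (dotC v u); field; rewrite lt0r_neq0.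
by rewrite mulr_ge0 ?dot_ge0 // invr_ge0 mulr_ge0 // ltW.
Qed.

(** After the strong convexity bound at [a], what remains is linear minus quadratic in [x - a], and
    Young's inequality bounds it. The bound is uniform in [x], so it also makes the supremum
    defining f^* finite. *)
Lemma dot_sub_le_fenchel_bound (R : realType) n (mu : R) (f : 'rV[R]_n -> R)
    (a u x : 'rV[R]_n) :
  0 < mu -> strongly_convex mu f ->
  dot u x - f x <=
    dot u a - f a + (2 * mu)^-1 * dot (u - grad f a) (u - grad f a).
Proof.
move=> mu0 /strongly_convex_dot /(_ a x).
move: (grad f a) (f x) (f a) => g fx fa.
rewrite -(subrK a x) -(subrK g u); move: (x - a) (u - g) => v k.
rewrite !addrK !dot_linE (dotC k a) (dotC g a) => h.
have := dot_le_amgm k v mu0; lra.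
Qed.

Lemma fenchel_le (R : realType) n (mu : R) (f : 'rV[R]_n -> R) (a u : 'rV[R]_n) :
  0 < mu -> strongly_convex mu f ->
  fenchel f u <=
    dot u a - f a + (2 * mu)^-1 * dot (u - grad f a) (u - grad f a).
Proof.
move=> mu0 cf; apply: ge_sup; first by exists (dot u a - f a), a.
by move=> _ [x _ <-]; exact: dot_sub_le_fenchel_bound.
Qed.

Lemma fenchel_young (R : realType) n (mu : R) (f : 'rV[R]_n -> R) (u x : 'rV[R]_n) :
  0 < mu -> strongly_convex mu f -> dot u x - f x <= fenchel f u.
Proof.
move=> mu0 cf; apply: ub_le_sup; last by exists x.
(* Any base point gives an upper bound of the set; 0 is taken. *)
eexists => _ [y _ <-]; exact: (dot_sub_le_fenchel_bound 0 _ _ mu0 cf).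
Qed.

(** The supremum is tested at [a + L^-1 *: (u - grad f a)], the maximizer once f is replaced by its
    descent-lemma upper model. This is the (1/L)-strong convexity of f^* at [grad f a]. *)
Lemma fenchel_ge (R : realType) n (L mu : R) (f : 'rV[R]_n -> R) (a u : 'rV[R]_n) :
  0 < L -> 0 < mu -> smooth L f -> strongly_convex mu f ->
  dot u a - f a + (2 * L)^-1 * dot (u - grad f a) (u - grad f a) <= fenchel f u.
Proof.
move=> L0 mu0 sf cf; set g := grad f a.
apply: le_trans (fenchel_young u (a + L^-1 *: (u - g)) mu0 cf).
have := smooth_upper_bound a (a + L^-1 *: (u - g)) L0 sf.
rewrite (addrC a) addrK -/g.
have -> : dot u a = dot (u - g) a + dot g a by rewrite -dotDl subrK.
rewrite -[X in dot X (_ + a)](subrK g u); move: (u - g) (f _) (f a) => k fx fa.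
rewrite !dot_linE => h.
have E : L / 2 * (L^-1 * (L^-1 * dot k k)) = L^-1 * dot k k - (2 * L)^-1 * dot k k.
  by field; rewrite lt0r_neq0.
lra.
Qed.

Lemma fenchel_grad (R : realType) n (mu : R) (f : 'rV[R]_n -> R) (a : 'rV[R]_n) :
  0 < mu -> strongly_convex mu f ->
  fenchel f (grad f a) = dot (grad f a) a - f a.
Proof.
move=> mu0 cf; apply/eqP; rewrite eq_le (fenchel_young _ _ mu0 cf) andbT.
by have := fenchel_le a (grad f a) mu0 cf; rewrite subrr dot0r mulr0 addr0.
Qed.

Lemma fenchel_remainder (R : realType) n (mu : R) (f : 'rV[R]_n -> R) (a v : 'rV[R]_n) :
  0 < mu -> strongly_convex mu f ->
  0 <= fenchel f (grad f a + v) - fenchel f (grad f a) - dot a v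
    <= (2 * mu)^-1 * dot v v.
Proof.
move=> mu0 cf; rewrite (fenchel_grad _ mu0 cf).
have := fenchel_le a (grad f a + v) mu0 cf.
have := fenchel_young (grad f a + v) a mu0 cf.
rewrite (addrC (grad f a)) addrK dotDl (dotC a) => h1 h2.
by apply/andP; split; lra.
Qed.

Lemma grad_fenchel_grad (R : realType) n (mu : R) (f : 'rV[R]_n -> R) (a : 'rV[R]_n) :
  0 < mu -> strongly_convex mu f -> grad (fenchel f) (grad f a) = a.
Proof.
move=> mu0 cf; apply: (grad_unique (C := (2 * mu)^-1)) => v.
by have /andP[h0 h1] := fenchel_remainder a v mu0 cf; rewrite ger0_norm.
Qed.

(** * Closed form of the regularizer's gradient, the operator and the proximal step *)

Lemma grad_regularizer (R : realType) d (mu : R) (f : 'rV[R]_d -> R) (x a : 'rV[R]_d) :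
  0 < mu -> strongly_convex mu f ->
  grad (regularizer mu f) (row_mx x (grad f a)) = row_mx (mu *: x) a.
Proof.
(* The two summands bound the remainders of the quadratic block and of f^*; their sum dominates
   both. *)
move=> mu0 cf; apply: (grad_unique (C := mu / 2 + (2 * mu)^-1)) => v.
rewrite -(hsubmxK v); move: (lsubmx v) (rsubmx v) => p q {v}.
rewrite add_row_mx /regularizer !row_mxKl !row_mxKr !dot_row_mx !sqr_norm2.
have /andP[h0 h1] := fenchel_remainder a q mu0 cf.
move: (fenchel f (_ + q)) (fenchel f (grad f a)) h0 h1 => F1 F0 h0 h1.
have mu2 : 0 < (2 * mu)^-1 by rewrite invr_gt0 mulr_gt0.
have ip := mulr_ge0 (ltW mu2) (dot_ge0 p).
have mq := mulr_ge0 (ltW mu0) (dot_ge0 q).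
have mp := mulr_ge0 (ltW mu0) (dot_ge0 p).
rewrite !dot_linE (dotC p x) ger0_norm; lra.
Qed.

Lemma saddle_op_row_mx (R : realType) d (mu : R) (f : 'rV[R]_d -> R) (x a : 'rV[R]_d) :
  0 < mu -> strongly_convex mu f ->
  saddle_op f (row_mx x (grad f a)) = row_mx (grad f a) (a - x).
Proof.
by move=> mu0 cf; rewrite /saddle_op row_mxKl row_mxKr (grad_fenchel_grad _ mu0 cf).
Qed.

(** The objective separates into blocks. The dual optimality condition is
    [grad (fenchel f) q = a - eta], solved by [q = grad f (a - eta)]. *)
Lemma prox_row_mx (R : realType) d (L mu : R) (f : 'rV[R]_d -> R) (x a xi eta : 'rV[R]_d) :
  0 < L -> 0 < mu -> smooth L f -> strongly_convex mu f ->
  prox (regularizer mu f) (row_mx x (grad f a)) (row_mx xi eta) =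
    row_mx (x - mu^-1 *: xi) (grad f (a - eta)).
Proof.
move=> L0 mu0 sf cf; rewrite /prox; set F := (fun w => _).
set w := row_mx _ (grad f (a - eta)).
(* Quadratic growth around [w], exact in the first block and by [fenchel_ge] in the second. It gives
   minimality of [w], and also the uniqueness required because [get] may return any minimizer. *)
have gap p q : mu / 2 * dot (p - (x - mu^-1 *: xi)) (p - (x - mu^-1 *: xi)) +
    (2 * L)^-1 * dot (q - grad f (a - eta)) (q - grad f (a - eta)) <=
    F (row_mx p q) - F w.
  rewrite /F /bregman (grad_regularizer _ _ mu0 cf) /w /regularizer.
  rewrite !opp_row_mx !add_row_mx !dot_row_mx !row_mxKl !row_mxKr !sqr_norm2.
  rewrite !(fenchel_grad _ mu0 cf).
  have := fenchel_ge (a - eta) q L0 mu0 sf cf.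
  have : xi = mu *: (x - (x - mu^-1 *: xi)).
    by rewrite opprB addrC subrK scalerA divff ?scale1r // lt0r_neq0.
  have : a = (a - eta) + eta by rewrite subrK.
  move: (a - eta) (x - mu^-1 *: xi) => b y -> ->.
  move: (f b) (grad f b) => fb gb.
  set E := (2 * L)^-1 * _; move: (fenchel f q) E => Fq E.
  move: (f (b + eta)) (grad f (b + eta)) => fa ga.
  rewrite !dot_linE (dotC x y) (dotC x p) (dotC y p) !(dotC _ q) !(dotC _ gb) !(dotC _ ga).
  lra.
have w_min : argmin F w.
  move=> u; rewrite -(hsubmxK u) -subr_ge0; apply: le_trans (gap _ _).
  by rewrite addr_ge0 // mulr_ge0 ?dot_ge0 // ?divr_ge0 ?invr_ge0 ?mulr_ge0 // ltW.
have /(_ w) := getPex (ex_intro _ w w_min).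
move: (get _) => u; rewrite -(hsubmxK u) -subr_le0.
move=> /(le_trans (gap _ _)).
set D1 := dot _ _; set D2 := dot _ _ => h.
have D1_0 : 0 <= mu / 2 * D1 by rewrite mulr_ge0 ?dot_ge0 // divr_ge0 // ltW.
have D2_0 : 0 <= (2 * L)^-1 * D2.
  by rewrite mulr_ge0 ?dot_ge0 // invr_ge0 mulr_ge0 // ltW.
rewrite /w; congr row_mx; apply/eqP; rewrite -subr_eq0; apply/eqP/dot_eq0.
  rewrite -/D1 -(pmulr_rle0 _ (_ : 0 < mu / 2)) ?divr_gt0 //; lra.
rewrite -/D2 -(pmulr_rle0 _ (_ : 0 < (2 * L)^-1)) ?invr_gt0 ?mulr_gt0 //; lra.
Qed.

(** * Consequences of smoothness and strong convexity for f *)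

Lemma grad_inj (R : realType) n (mu : R) (f : 'rV[R]_n -> R) :
  0 < mu -> strongly_convex mu f -> injective (grad f).
Proof.
by move=> mu0 cf a b ab; rewrite -(grad_fenchel_grad a mu0 cf) ab (grad_fenchel_grad b mu0 cf).
Qed.

Lemma strongly_convex_tangent (R : realType) n (mu : R) (f : 'rV[R]_n -> R)
    (x y : 'rV[R]_n) :
  0 < mu -> strongly_convex mu f -> f x + dot (grad f x) (y - x) <= f y.
Proof.
move=> mu0 cf; apply: le_trans (strongly_convex_dot cf x y).
by rewrite lerDl mulr_ge0 ?dot_ge0 // divr_ge0 // ltW.
Qed.

(** Strong convexity of f^* read at [u = grad f b], where f^* is explicit. *)
Lemma cocoercive (R : realType) n (L mu : R) (f : 'rV[R]_n -> R) (a b : 'rV[R]_n) :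
  0 < L -> 0 < mu -> smooth L f -> strongly_convex mu f ->
  (2 * L)^-1 * dot (grad f b - grad f a) (grad f b - grad f a) <=
    f a - f b - dot (grad f b) (a - b).
Proof.
move=> L0 mu0 sf cf; have := fenchel_ge a (grad f b) L0 mu0 sf cf.
rewrite (fenchel_grad _ mu0 cf) [dot _ (a - b)]dotDr dotNr; lra.
Qed.

(** A gradient step of length 1/L from [x] would lower f by at least |grad f x|^2 / (2L). *)
Lemma grad_argmin (R : realType) n (L : R) (f : 'rV[R]_n -> R) (x : 'rV[R]_n) :
  0 < L -> smooth L f -> argmin f x -> grad f x = 0.
Proof.
move=> L0 sf xmin; apply: dot_eq0.
have := xmin (x - L^-1 *: grad f x).
have := smooth_upper_bound x (x - L^-1 *: grad f x) L0 sf.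
rewrite (addrC x) addrK; move: (grad f x) => g; rewrite !dot_linE => h1 h2.
have E : L / 2 * (- - (L^-1 * (L^-1 * dot g g))) = L^-1 * dot g g / 2.
  by field; rewrite lt0r_neq0.
rewrite -(pmulr_rle0 _ (_ : 0 < L^-1)) ?invr_gt0 //; lra.
Qed.

(** Here the gradient is constant, yet injective by strong convexity, so the space is a single
    point. This settles the degenerate case of the theorem. *)
Lemma smooth_le0_eq (R : realType) n (L mu : R) (f : 'rV[R]_n -> R) (x y : 'rV[R]_n) :
  L <= 0 -> 0 < mu -> smooth L f -> strongly_convex mu f -> x = y.
Proof.
move=> L0 mu0 [_ lf] cf; apply: (grad_inj mu0 cf).
apply/eqP; rewrite -subr_eq0; apply/eqP/dot_eq0.
have := le_trans (lf x y) (mulr_le0_ge0 L0 (sqrtr_ge0 _)).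
rewrite -sqr_norm2 => h; have -> : norm2 (grad f x - grad f y) = 0.
  by apply/eqP; rewrite eq_le h sqrtr_ge0.
by rewrite expr0n.
Qed.

(* At u = xstar this is V^r_z(xstar, 0) for z = (x, grad f a), as grad f xstar = 0. *)
Definition potential (R : realType) n (mu : R) (f : 'rV[R]_n -> R)
    (u x a : 'rV[R]_n) : R :=
  mu / 2 * dot (x - u) (x - u) + (f a - f u).

(** * Regret of one extragradient step *)

(** The four equations are the closed form of the two proximal steps, with lambda = 1 + kappa and L
    = kappa^2 mu. *)
Lemma extragradient_step (R : realType) n (kappa mu : R) (f : 'rV[R]_n -> R)
    (u x p x' a b a' : 'rV[R]_n) :
  0 < kappa -> 0 < mu -> smooth (kappa ^+ 2 * mu) f -> strongly_convex mu f ->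
  a - b = (1 + kappa)^-1 *: (a - x) ->
  x - p = ((1 + kappa) * mu)^-1 *: grad f a ->
  a - a' = (1 + kappa)^-1 *: (b - p) ->
  x - x' = ((1 + kappa) * mu)^-1 *: grad f b ->
  f b - f u <=
    (1 + kappa) * (potential mu f u x a - potential mu f u x' a').
Proof.
move=> k0 mu0 sf cf Eb Ep Ea' Ex'.
have L0 : 0 < kappa ^+ 2 * mu by rewrite mulr_gt0 ?exprn_gt0.
have l0 : 1 + kappa != 0 by rewrite lt0r_neq0 // addr_gt0.
have lmu0 : (1 + kappa) * mu != 0 by rewrite mulf_neq0 // lt0r_neq0.
have {Ep} Ga : grad f a = ((1 + kappa) * mu) *: (x - p).
  by rewrite Ep scalerA divff // scale1r.
have {Ex'} Gb : grad f b = ((1 + kappa) * mu) *: (x - x').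
  by rewrite Ex' scalerA divff // scale1r.
have {Eb} Ex : x = a - (1 + kappa) *: (a - b).
  by rewrite Eb scalerA divff // scale1r opprB addrC subrK.
have {Ea'} Ep : p = b - (1 + kappa) *: (a - a').
  by rewrite Ea' scalerA divff // scale1r opprB addrC subrK.
(* The bracket is the divergence of f^* from [grad f c] to [grad f e]. The AM-GM weight [kappa * mu]
   is chosen so that its dual term equals kappa times the cocoercivity term. *)
have relative_lipschitz (c e v : 'rV[R]_n) :
    dot (grad f e - grad f c) v <=
    kappa * (f c - f e - dot (grad f e) (c - e)) + kappa * mu / 2 * dot v v.
  have := cocoercive c e L0 mu0 sf cf; rewrite -(ler_pM2l k0).
  have := dot_le_amgm (grad f e - grad f c) v (mulr_gt0 k0 mu0).
  move: (dot (grad f e - grad f c) (grad f e - grad f c)) => D.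
  have -> : kappa * ((2 * (kappa ^+ 2 * mu))^-1 * D) = (2 * (kappa * mu))^-1 * D.
    by field; rewrite !lt0r_neq0.
  lra.
(* The three points are w = (p, grad f b), z = (x, grad f a), z' = (x', grad f a');
   the hypothesis h2 is the divergence V_z(z') left over in the three-point identity. *)
have h1 := strongly_convex_tangent b u mu0 cf.
have h2 := strongly_convex_tangent a' a mu0 cf.
(* h3 and h4 bound the bilinear coupling by kappa (V_z(w) + V_w(z')). The remaining unit of 1 +
   kappa pays for the grad f^* part of g, and h5, h6 discard the leftover squares. *)
have h3 := relative_lipschitz a b (p - x').
have h4 := relative_lipschitz b a' (p - x).
have h5 := mulr_ge0 (ltW mu0) (dot_ge0 (p - x)).
have h6 := mulr_ge0 (ltW mu0) (dot_ge0 (p - x')).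
rewrite /potential; move: h1 h2 h3 h4 h5 h6; rewrite Ga Gb.
move: (grad f a') (f a) (f b) (f a') (f u) => g fa fb fa' fu.
rewrite Ep Ex {Ep Ex Ga Gb relative_lipschitz sf cf}.
rewrite !dot_linE !(dotC g) !(dotC u) !(dotC x') (dotC a' a) (dotC a' b) (dotC b a).
lra.
Qed.

(** * Averaging, telescoping and the final bound *)

(** Tangent bounds at the mean are summed; their linear terms cancel. *)
Lemma jensen (R : realType) n (mu : R) (f : 'rV[R]_n -> R) (T : nat)
    (v : nat -> 'rV[R]_n) :
  0 < mu -> strongly_convex mu f -> (0 < T)%N ->
  T%:R * f (T%:R^-1 *: \sum_(0 <= t < T) v t) <= \sum_(0 <= t < T) f (v t).
Proof.
move=> mu0 cf T0; set c := _ *: _.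
have : \sum_(0 <= t < T) (f c + dot (grad f c) (v t - c)) <= \sum_(0 <= t < T) f (v t).
  by apply: ler_sum => t _; exact: (strongly_convex_tangent _ _ mu0 cf).
rewrite big_split /= -dot_sumr sumrB !sumr_const_nat subn0.
have -> : \sum_(0 <= t < T) v t = c *+ T.
  by rewrite -scaler_nat /c scalerA divff ?scale1r // pnatr_eq0 -lt0n.
by rewrite subrr dot0r addr0 mulr_natl.
Qed.

Unset Implicit Arguments.

Theorem theorem1 (R : realType) (d : nat) (f : 'rV[R]_d -> R) (L mu lambda : R)
    (xstar x0 : 'rV[R]_d) (T : nat) (z w : nat -> 'rV[R]_(d + d))
    (xhalf vhalf : nat -> 'rV[R]_d) (vbar : 'rV[R]_d)
    (hmu : 0 < mu)
    (hsmooth : smooth L f)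
    (hconvex : strongly_convex mu f)
    (hxstar : argmin f xstar)
    (hlambda : lambda = 1 + Num.sqrt (L / mu))
    (hT : 4 * lambda <= T%:R)
    (hz0 : z 0%N = row_mx x0 (grad f x0))
    (hw : forall t : nat, (t < T)%N ->
      w t = prox (regularizer mu f) (z t) (lambda^-1 *: saddle_op f (z t)))
    (hz : forall t : nat, (t < T)%N ->
      z t.+1 = prox (regularizer mu f) (z t) (lambda^-1 *: saddle_op f (w t)))
    (hhalf : forall t : nat, (t < T)%N ->
      w t = row_mx (xhalf t) (grad f (vhalf t)))
    (hvbar : vbar = T%:R^-1 *: \sum_(0 <= t < T) vhalf t) :
  f vbar - f xstar <= 2^-1 * (f x0 - f xstar).
Proof.
have [L_le0|L0] := lerP L 0.
  have eqf u : f u = f xstar.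
    by rewrite (smooth_le0_eq u xstar L_le0 hmu hsmooth hconvex).
  by rewrite !eqf subrr mulr0.
set kappa := Num.sqrt (L / mu) in hlambda.
have k0 : 0 < kappa by rewrite sqrtr_gt0 divr_gt0.
have EL : L = kappa ^+ 2 * mu.
  by rewrite sqr_sqrtr ?divfK ?lt0r_neq0 // divr_ge0 // ltW.
have l0 : 0 < lambda by rewrite hlambda addr_gt0.
have potential_ge0 x a : 0 <= potential mu f xstar x a.
  rewrite addr_ge0 ?subr_ge0 ?hxstar // mulr_ge0 ?dot_ge0 //.
  by rewrite divr_ge0 // ltW.
(* Besides the telescoped regret, the induction carries the form of [z t] that makes the next
   proximal step explicit. *)
have invariant t : (t <= T)%N -> exists x a, z t = row_mx x (grad f a) /\
    \sum_(0 <= s < t) (f (vhalf s) - f xstar) +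
      lambda * potential mu f xstar x a <=
    lambda * potential mu f xstar x0 x0.
  elim: t => [_|t IH tT].
    by exists x0, x0; split => //; rewrite big_geq // add0r.
  have [x [a [zt le_t]]] := IH (ltnW tT).
  have wt := hw t tT; rewrite zt (saddle_op_row_mx _ _ hmu hconvex) in wt.
  rewrite scale_row_mx (prox_row_mx _ _ _ _ L0 hmu hsmooth hconvex) in wt.
  set p := x - _ in wt; set b := a - _ in wt.
  (* [vhalf t] is known only through its gradient; injectivity of [grad f] recovers it. *)
  have Eb : vhalf t = b.
    by apply: (grad_inj hmu hconvex); have := hhalf t tT; rewrite wt => /eq_row_mx[].
  have := hz t tT; rewrite zt wt (saddle_op_row_mx _ _ hmu hconvex).
  rewrite scale_row_mx (prox_row_mx _ _ _ _ L0 hmu hsmooth hconvex).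
  set x' := x - _; set a' := a - _ => zt1.
  exists x', a'; split => //.
  rewrite big_nat_recr //= Eb.
  suff : f b - f xstar <=
      lambda * (potential mu f xstar x a - potential mu f xstar x' a').
    by rewrite mulrBr; lra.
  rewrite EL in hsmooth; rewrite hlambda.
  apply: (@extragradient_step _ _ _ _ _ _ x p) => //.
  - by rewrite /b subKr hlambda.
  - by rewrite /p subKr scalerA invfM mulrC hlambda.
  - by rewrite /a' subKr hlambda.
  - by rewrite /x' subKr scalerA invfM mulrC hlambda.
have [x [a [_ sum_le]]] := invariant T (leqnn T).
have T0 : (0 < T)%N.
  by rewrite -(ltr0n R); apply: lt_le_trans hT; rewrite mulr_gt0.
(* Strong convexity at [xstar], where the gradient vanishes, bounds the quadratic half of the
   potential by the gap [f x0 - f xstar]; the other half is that gap. *)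
have x0_le : potential mu f xstar x0 x0 <= 2 * (f x0 - f xstar).
  have := strongly_convex_dot hconvex xstar x0.
  rewrite (grad_argmin L0 hsmooth hxstar) dotC dot0r /potential; lra.
have := jensen vhalf hmu hconvex T0; rewrite -hvbar => jen.
rewrite sumrB sumr_const_nat subn0 -mulr_natl in sum_le.
have p0 := mulr_ge0 (ltW l0) (potential_ge0 x a).
rewrite -(ler_pM2l (_ : 0 < T%:R)) ?ltr0n //.
have := ler_wpM2l (ltW l0) x0_le.
(* The regret 2 lambda (f x0 - f xstar) is thus at most T/2 times the initial gap. *)
have : 4 * lambda * (f x0 - f xstar) <= T%:R * (f x0 - f xstar).
  by rewrite ler_wpM2r // subr_ge0 hxstar.
lra.
Qed.
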